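(* $\mathbf{CF}\subseteq\mathbf{P_{/poly}}$.
   Context: Binary strings of length $n$ are identified with vectors in $\{0,1\}^n$. $\mathbf{CF}$ is the set of languages $L\subseteq\{0,1\}^*$ for which there exists a polynomial $p$ such that for every $n\in\mathbb{N}$ there exist $A\in\mathbb{R}^{p(n)\times n}$, $B\in\mathbb{R}^{p(n)\times p(n)}$, $b\in\mathbb{R}^{p(n)}$ with $\operatorname{conv}(\{x\in L: |x|=n\})=\{x\in\mathbb{R}^n\mid\exists y\in\mathbb{R}^{p(n)}: Ax+By\le b\}$. $\mathbf{P_{/poly}}$ is the class of languages decidable by families of polynomial-size Boolean circuits (equivalently, by polynomial-time Turing machines with polynomial-length advice depending only on the input length). *)

(* Defs.v *)
From HB Require Import structures.
From mathcomp Require Import all_boot all_order all_algebra.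
From mathcomp Require Import Rstruct.
From Stdlib Require Rdefinitions.
Notation R := Rdefinitions.R.
Set Implicit Arguments. Unset Strict Implicit. Unset Printing Implicit Defensive.
Import Order.TTheory GRing.Theory Num.Theory.
Local Open Scope ring_scope.

Definition language := seq bool -> Prop.

Definition is_polynomial (p : nat -> nat) : Prop :=
  exists cs : seq nat, forall n, p n = (\sum_(i < size cs) nth 0%N cs i * n ^ i)%N.

Definition bitvec (n : nat) (t : n.-tuple bool) : 'cV[R]_n :=
  \col_i (if tnth t i then 1 else 0).

Definition conv_slice (L : language) (n : nat) (x : 'cV[R]_n) : Prop :=
  exists w : {ffun n.-tuple bool -> R},
    (forall t, 0 <= w t) /\
    (forall t, ~ L (tval t) -> w t = 0) /\
    \sum_t w t = 1 /\
    x = \sum_t w t *: bitvec t.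

Definition CF (L : language) : Prop :=
  exists p : nat -> nat, is_polynomial p /\
    forall n : nat, exists (A : 'M[R]_(p n, n)) (B : 'M[R]_(p n, p n))
                           (b : 'cV[R]_(p n)),
      forall x : 'cV[R]_n,
        conv_slice L x <->
        exists y : 'cV[R]_(p n), forall i, (A *m x + B *m y) i 0 <= b i 0.

(* Boolean circuits as straight-line programs over the basis {AND, OR, NOT}
   plus constants.  Wires 0..n-1 are the inputs; gate k creates wire n+k and
   may only refer to wires < n+k.  The output is the last wire. *)
Inductive gate : Type :=
| GConst of bool
| GNot of nat
| GAnd of nat & nat
| GOr of nat & nat.

Definition gate_wf (m : nat) (g : gate) : bool :=
  match g with
  | GConst _ => true
  | GNot i => (i < m)%N
  | GAnd i j | GOr i j => (i < m)%N && (j < m)%N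
  end.

Definition circuit := seq gate.

Fixpoint circuit_wf_from (m : nat) (c : circuit) : bool :=
  match c with
  | [::] => true
  | g :: c' => gate_wf m g && circuit_wf_from m.+1 c'
  end.

Definition circuit_wf (n : nat) (c : circuit) : bool := circuit_wf_from n c.

Definition eval_gate (w : seq bool) (g : gate) : bool :=
  match g with
  | GConst b => b
  | GNot i => ~~ nth false w i
  | GAnd i j => nth false w i && nth false w j
  | GOr i j => nth false w i || nth false w j
  end.

Definition circuit_wires (c : circuit) (x : seq bool) : seq bool :=
  foldl (fun w g => rcons w (eval_gate w g)) x c.

Definition circuit_out (c : circuit) (x : seq bool) : bool :=
  last false (circuit_wires c x).

Definition Ppoly (L : language) : Prop :=
  exists p : nat -> nat, is_polynomial p /\
    forall n : nat, exists c : circuit,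
      circuit_wf n c /\ (size c <= p n)%N /\
      forall x : seq bool, size x = n -> (L x <-> circuit_out c x = true).

(* Main.v *)
Require Import Defs.
From mathcomp Require Import all_boot all_order all_algebra.
From mathcomp Require Import Rstruct boolp.
From mathcomp Require Import ring lra zify.
Set Implicit Arguments. Unset Strict Implicit. Unset Printing Implicit Defensive.
Import Order.TTheory GRing.Theory Num.Theory.

(** Write H for the Hamming distance and fix a length n with L_n nonempty.  For
    z outside L, the inequality H(z, .) >= 1 holds on conv L_n, so Farkas' lemma
    applied to A x + B y <= b, H(z, x) <= 1/2 turns the extended formulation
    into a nonnegative factorization
      2 H(z, x) - 1 = sum_k u_k(z) v_k(x)   (z outside L, x in L)
    with p(n) + 1 terms, which can be rescaled so that u <= 1 and v <= 2n + 2.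
    At z = x the left-hand side is -1: this constant gap replaces any control
    on the coefficients of A, B and b.

    A barycentric spanner (a maximal minor) reduces the exponentially many z to
    m = poly(n) points z_j: the row (u(z), z, 1) of every other z is a
    combination of their rows with coefficients in [-1, 1].  Rounding at scale
    Q = poly(n), the points P_k = ([Q V u_k(z_j)] - Q (2 H(z_j, x) - 1))_j of
    Z^m have a convex combination in the unit cube if x is in L, while if x is
    not in L some functional with coefficients in [-1, 1] is at least Q - m on
    all of them.  The perceptron algorithm distinguishes the two cases in
    polynomially many steps, on integers of polynomial absolute value, and
    one-hot encodings of such integers allow any binary operation on them to be
    computed by a circuit of polynomial size. *)

(** * Circuits *)

Lemma circuit_wf_from_cat m c d :
  circuit_wf_from m (c ++ d) = circuit_wf_from m c && circuit_wf_from (m + size c) d.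
Proof.
by elim: c m => [|g c IH] m /=; rewrite ?addn0 // IH addSnnS andbA.
Qed.

Lemma circuit_wires_cat c d x :
  circuit_wires (c ++ d) x = circuit_wires d (circuit_wires c x).
Proof. by rewrite /circuit_wires foldl_cat. Qed.

Lemma size_circuit_wires c x : size (circuit_wires c x) = size x + size c.
Proof.
by elim: c x => [|g c IH] x /=; rewrite ?addn0 // IH size_rcons addSnnS.
Qed.

Lemma nth_circuit_wires c x i :
  i < size x -> nth false (circuit_wires c x) i = nth false x i.
Proof.
elim: c x => [|g c IH] x //= ix.
by rewrite IH ?size_rcons ?(leqW ix) // nth_rcons ix.
Qed.

Section Computable.
Variable n : nat.

Definition available (c : circuit) (f : seq bool -> bool) : Prop :=
  exists2 i, i < n + size c &
    forall x, size x = n -> nth false (circuit_wires c x) i = f x.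

Lemma available_cat c d f : available c f -> available (c ++ d) f.
Proof.
move=> [i ic iP]; exists i => [|x sx]; first by rewrite size_cat addnA ltn_addr.
by rewrite circuit_wires_cat nth_circuit_wires ?size_circuit_wires ?sx ?iP.
Qed.

Lemma available_input i : i < n -> available [::] (fun x => nth false x i).
Proof. by move=> ilt; exists i; rewrite ?addn0. Qed.

Section Extensible.
Variables (X : Type) (av : circuit -> X -> Prop).
Hypothesis av_cat : forall c d f, av c f -> av (c ++ d) f.

(** A Hoare triple with a cost. Quantifying over every circuit [c] that provides [F] makes costs add
    up under composition. [X] and [av] are abstract because Boolean signals and one-hot integers are
    composed in the same way. *)
Definition extensible (s : nat) (F G : X -> Prop) : Prop :=
  forall c, circuit_wf n c -> (forall f, F f -> av c f) ->
  exists d, [/\ circuit_wf n (c ++ d), size d <= s & forall g, G g -> av (c ++ d) g].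

Lemma extensible_sub s s' (F F' G G' : X -> Prop) :
  (forall f, F f -> F' f) -> (forall g, G' g -> G g) -> s <= s' ->
  extensible s F G -> extensible s' F' G'.
Proof.
move=> FF' GG' ss' e c wc Fc; have [f /FF'/Fc//|d [wd sd Gd]] := e c wc.
by exists d; split=> [//||g /GG'/Gd]; first exact: leq_trans ss'.
Qed.

Lemma extensible_refl F : extensible 0 F F.
Proof. by move=> c wc Fc; exists [::]; rewrite cats0. Qed.

Lemma extensible_trans s t F G H :
  extensible s F G -> extensible t G H -> extensible (s + t) F H.
Proof.
move=> eG eH c wc Fc; have [d [wd sd Gd]] := eG c wc Fc.
have [d' [wd' sd' Hd']] := eH _ wd Gd.
by exists (d ++ d'); rewrite catA size_cat leq_add.
Qed.

Lemma extensible_keep s F G :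
  extensible s F G -> extensible s F (fun f => F f \/ G f).
Proof.
move=> e c wc Fc; have [d [wd sd Gd]] := e c wc Fc; exists d; split=> // f [/Fc|/Gd] //.
exact: av_cat.
Qed.

Lemma extensible_let s t F G H :
  extensible s F G -> extensible t (fun f => F f \/ G f) H ->
  extensible (s + t) F H.
Proof. by move/extensible_keep; apply: extensible_trans. Qed.

Lemma extensible_iter s N (F : nat -> X -> Prop) :
  (forall i, i < N -> extensible s (F i) (F i.+1)) -> extensible (N * s) (F 0) (F N).
Proof.
elim: N => [|N IH] e; first exact: extensible_refl.
rewrite mulSn addnC; apply: extensible_trans (e N _) => //.
by apply: IH => i iN; apply: e; exact: leqW.
Qed.

Lemma extensible_bigcup s N (F : X -> Prop) (G : nat -> X -> Prop) :
  (forall i, i < N -> extensible s F (G i)) ->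
  extensible (N * s) F (fun f => exists2 i, i < N & G i f).
Proof.
(* Invariant: the signals of [F] and those of the first [N] families. *)
move=> e; pose H N f := F f \/ exists2 i, i < N & G i f.
apply: (@extensible_sub (N * s) _ (H 0) _ (H N)) => //.
- by move=> f [//|[]].
- by move=> g; right.
apply: extensible_iter => i iN.
have eH : extensible s (H i) (G i).
  by apply: extensible_sub (e i iN) => // f; left.
apply: extensible_sub (extensible_keep eH) => //.
move=> f [Ff|[j]]; first by left; left.
rewrite ltnS leq_eqVlt => /orP[/eqP->|ji] Gf; first by right.
by left; right; exists j.
Qed.

Lemma extensible_union s t F G H :
  extensible s F G -> extensible t F H ->
  extensible (s + t) F (fun f => G f \/ H f).
Proof.
move=> eG eH c wc Fc; have [d [wd sd Gd]] := eG c wc Fc.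
have [f /Fc /av_cat|d' [wd' sd' Hd']] := eH _ wd; first exact.
exists (d ++ d'); rewrite catA size_cat leq_add //; split=> // f [/Gd|/Hd'] //.
exact: av_cat.
Qed.

(** Only the latest accumulator is carried along with [F], so that all rounds have the same form. *)
Lemma extensible_fold s0 s N F (a : nat -> X) :
  extensible s0 F (eq (a 0)) ->
  (forall i, i < N -> extensible s (fun f => F f \/ a i = f) (eq (a i.+1))) ->
  extensible (s0 + N * s) F (eq (a N)).
Proof.
move=> e0 e; apply: (@extensible_sub (s0 + N * s) _ F _ (fun f => F f \/ a N = f)) => //.
  by move=> g; right.
apply: extensible_trans (extensible_keep e0) _.
apply: (@extensible_iter s N (fun i f => F f \/ a i = f)) => i iN.
apply: extensible_sub (extensible_keep (e i iN)) => //.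
by move=> f [Ff|af]; [left; left|right].
Qed.

End Extensible.

(** The gate may depend on [c], since the positions of the wires that carry [F] are known only
    there. *)
Lemma extensible_gate (F : (seq bool -> bool) -> Prop) h :
  (forall c, circuit_wf n c -> (forall f, F f -> available c f) ->
     exists2 g, gate_wf (n + size c) g & forall x, size x = n ->
       eval_gate (circuit_wires c x) g = h x) ->
  extensible available 1 F (eq h).
Proof.
move=> gP c wc Fc; have [g wg gE] := gP c wc Fc; exists [:: g]; split=> //.
  by rewrite /circuit_wf circuit_wf_from_cat [circuit_wf_from n c]wc /= wg.
move=> _ <-; exists (n + size c) => [|x sx].
  by rewrite size_cat addnA addn1.
by rewrite circuit_wires_cat /= nth_rcons size_circuit_wires sx ltnn eqxx gE.
Qed.

Lemma extensible_const F b : extensible available 1 F (eq (fun=> b)).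
Proof. by apply: extensible_gate => c _ _; exists (GConst b). Qed.

Lemma extensible_not (F : (seq bool -> bool) -> Prop) f :
  F f -> extensible available 1 F (eq (fun x => ~~ f x)).
Proof.
move=> Ff; apply: extensible_gate => c _ /(_ f Ff)[i ic iP].
by exists (GNot i) => //= x /iP->.
Qed.

Lemma extensible_and (F : (seq bool -> bool) -> Prop) f g :
  F f -> F g -> extensible available 1 F (eq (fun x => f x && g x)).
Proof.
move=> Ff Fg; apply: extensible_gate => c _ Fc.
have [[i ic iP] [j jc jP]] := (Fc f Ff, Fc g Fg).
by exists (GAnd i j) => /= [|x sx]; rewrite ?ic ?jc // iP // jP.
Qed.

Lemma extensible_or (F : (seq bool -> bool) -> Prop) f g :
  F f -> F g -> extensible available 1 F (eq (fun x => f x || g x)).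
Proof.
move=> Ff Fg; apply: extensible_gate => c _ Fc.
have [[i ic iP] [j jc jP]] := (Fc f Ff, Fc g Fg).
by exists (GOr i j) => /= [|x sx]; rewrite ?ic ?jc // iP // jP.
Qed.

(** A lookup table on one-hot operands has this form, each entry being a conjunction of two wires.
    [List.In] asks for no decidable equality of functions. *)
Lemma extensible_has_and (F : (seq bool -> bool) -> Prop)
    (l : seq ((seq bool -> bool) * (seq bool -> bool))) :
  (forall p, List.In p l -> F p.1 /\ F p.2) ->
  extensible available (2 * size l).+1 F (eq (fun x => has (fun p => p.1 x && p.2 x) l)).
Proof.
elim: l => [|[f g] l IH] Fl /=; first exact: extensible_const.
have [Ff Fg] := Fl _ (or_introl erefl).
have eand := extensible_and Ff Fg.
have eor := extensible_union available_cat eand (IH (fun p pl => Fl p (or_intror pl))).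
apply: extensible_sub (extensible_trans eor (extensible_or _ _)); last 2 first.
- by left.
- by right.
- by [].
- by [].
- by rewrite mulnS add2n addn1 add1n.
Qed.

End Computable.

(** * Integers in one-hot encoding *)

Section IntSignals.
Variables (n M : nat).

(* One-hot encoding; nothing is said at the inputs where [`|f x| > M]. *)
Definition available_int (c : circuit) (f : seq bool -> int) : Prop :=
  forall a : int, (`|a| <= M)%N -> available n c (fun x => f x == a).

Definition bounded (f : seq bool -> int) : Prop :=
  forall x, size x = n -> (`|f x| <= M)%N.

Lemma available_int_cat c d f : available_int c f -> available_int (c ++ d) f.
Proof. by move=> cf a aM; apply/available_cat/cf. Qed.

Lemma available_ext c f g : available n c f ->
  (forall x, size x = n -> f x = g x) -> available n c g.
Proof. by move=> [i ic iP] fg; exists i => // x sx; rewrite iP ?fg. Qed.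

(** One lookup table for each of the [2 * M + 1] values of the result, each with at most
    [(2 * M + 1) ^ 2] pairs of operands. *)
Definition op_cost : nat := (2 * M).+1 * (2 * (2 * M).+1 ^ 2).+1.

(** All of [available n c] serves as the set of Boolean signals at hand, so that each value from
    [-M] to [M] becomes a separate Boolean problem. *)
Lemma extensible_int (F : (seq bool -> int) -> Prop) (h : seq bool -> int) s :
  (forall c (a : int), (forall f, F f -> available_int c f) ->
     exists2 g, extensible n (available n) s (available n c) (eq g) &
       forall x, size x = n -> g x = (h x == a)) ->
  extensible n available_int ((2 * M).+1 * s) F (eq h).
Proof.
move=> hP c wc Fc.
pose b i : seq bool -> bool := fun x => (h x == i%:Z - M%:Z)%R.
have e i : i < (2 * M).+1 -> extensible n (available n) s (available n c) (eq (b i)).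
  move=> _; have [g eg gE] := hP c (i%:Z - M%:Z)%R Fc => c' wc' Fc'.
  have [d [wd sd gd]] := eg c' wc' Fc'; exists d; split=> // _ <-.
  by apply: available_ext (gd g erefl) _.
have [//|d [wd sd hd]] := extensible_bigcup (@available_cat n) e wc.
exists d; split=> // _ <- a aM.
have [i ilt aE] : exists2 i, i < (2 * M).+1 & a = (i%:Z - M%:Z)%R.
  by exists `|(a + M%:Z)%R|%N; lia.
by apply: hd; exists i => //; rewrite aE.
Qed.

(** Table lookup: [h x = a] exactly when [(f x, g x)] is one of the finitely many pairs in range
    that [phi] sends to [a]. *)
Lemma extensible_op (F : (seq bool -> int) -> Prop) f g h (phi : int -> int -> int) :
  F f -> F g -> bounded f -> bounded g ->
  (forall x, size x = n -> h x = phi (f x) (g x)) ->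
  extensible n available_int op_cost F (eq h).
Proof.
move=> Ff Fg bf bg hE; apply: extensible_int => c a Fc.
pose r := [seq (i%:Z - M%:Z)%R | i <- iota 0 (2 * M).+1].
have rP (v : int) : (`|v| <= M)%N -> v \in r.
  move=> vM; apply/mapP; exists `|(v + M%:Z)%R|%N; rewrite ?mem_iota; lia.
have rM (v : int) : v \in r -> (`|v| <= M)%N.
  by case/mapP=> i; rewrite mem_iota => ilt ->; lia.
pose q := [seq p <- [seq (u, v) | u <- r, v <- r] | phi p.1 p.2 == a].
have qP u v : (u, v) \in q = [&& phi u v == a, u \in r & v \in r].
  rewrite mem_filter; congr (_ && _).
  by apply/allpairsPdep/andP => [[u' [v' [? ? [-> ->]]]]|[ur vr]] //; exists u, v.
pose l := [seq ((fun x => f x == p.1), (fun x => g x == p.2)) | p <- q].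
have el : extensible n (available n) (2 * size l).+1 (available n c)
    (eq (fun x => has (fun p => p.1 x && p.2 x) l)).
  apply: extensible_has_and => _ /List.in_map_iff[[u v] [<- uvq]] /=.
  have : (u, v) \in q.
    elim: (q) uvq => //= w q' IH [->|/IH]; rewrite inE ?eqxx // => ->.
    by rewrite orbT.
  by rewrite qP => /and3P[_ /rM uM /rM vM]; split; apply: Fc.
have sl : size l <= (2 * M).+1 ^ 2.
  rewrite size_map size_filter; apply: leq_trans (count_size _ _) _.
  by rewrite size_allpairs size_map size_iota expnS expn1.
exists (fun x => has (fun p => p.1 x && p.2 x) l).
  by apply: extensible_sub el => //; rewrite ltnS leq_mul2l.
move=> x sx; rewrite hE // /l has_map; apply/hasP/eqP => [[[u v] + /= /andP[/eqP-> /eqP->]]|pa].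
  by rewrite qP => /and3P[/eqP].
by exists (f x, g x); rewrite /= ?eqxx // qP pa eqxx !rP ?bf ?bg.
Qed.

Lemma extensible_int1 (F : (seq bool -> int) -> Prop) (h : seq bool -> int) :
  (forall c (a : int), (forall f, F f -> available_int c f) ->
     exists2 g, extensible n (available n) 1 (available n c) (eq g) &
       forall x, size x = n -> g x = (h x == a)) ->
  extensible n available_int op_cost F (eq h).
Proof. by move/extensible_int; apply: extensible_sub; rewrite // leq_mul2l. Qed.

Lemma extensible_int_const F h (k : int) :
  (forall x, size x = n -> h x = k) -> extensible n available_int op_cost F (eq h).
Proof.
move=> hk; apply: extensible_int1 => c a _.
by exists (fun=> k == a) => [|x /hk->] //; apply: extensible_const.
Qed.

Lemma extensible_int_input F i : i < n ->
  extensible n available_int op_cost F (eq (fun x => Posz (nth false x i))).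
Proof.
move=> ilt; apply: extensible_int1 => c a _.
have inp : available n c (fun x => nth false x i).
  by rewrite -[c]cat0s; apply/available_cat/available_input.
have [->|a0] := eqVneq a 0%R.
  exists (fun x => ~~ nth false x i); first exact: extensible_not.
  by move=> x _; case: nth.
have [->|a1] := eqVneq a 1%R.
  exists (fun x => nth false x i); last by move=> x _; case: nth.
  by move=> c' wc' Fc'; exists [::]; rewrite cats0; split=> // _ <-; apply: Fc'.
exists (fun=> false); first exact: extensible_const.
by move=> x _; case: nth; apply/esym/negbTE; rewrite eq_sym.
Qed.

Lemma extensible_op1 (F : (seq bool -> int) -> Prop) f h (phi : int -> int) :
  F f -> bounded f -> (forall x, size x = n -> h x = phi (f x)) ->
  extensible n available_int op_cost F (eq h).
Proof. by move=> Ff bf hE; apply: (extensible_op (phi := fun u _ => phi u) Ff Ff). Qed.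

Lemma circuit_of_signal s h : 0 < M ->
  extensible n available_int s (fun=> False) (eq h) ->
  exists c, [/\ circuit_wf n c, size c <= s.+1 &
    forall x, size x = n -> circuit_out c x = (h x == 1%R)].
Proof.
move=> M0 e; have [//|//|d [wd sd hd]] := e [::].
have [] // := hd h erefl 1%R => i ilt iP.
(* The output is the last wire, so the wire for the value 1 is copied there by an OR with itself. *)
exists (d ++ [:: GOr i i]); split.
- by rewrite /circuit_wf circuit_wf_from_cat [circuit_wf_from n d]wd /= ilt.
- by rewrite size_cat addn1.
by move=> x sx; rewrite /circuit_out circuit_wires_cat /= last_rcons iP // orbb.
Qed.

End IntSignals.

(** * Polynomial bounds *)

(** Evaluation in [{poly nat}] respects sums and products, which gives the closure properties
    below. *)
Lemma is_polynomialP (p : nat -> nat) :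
  is_polynomial p <-> exists q : {poly nat}, forall n, p n = (q.[n])%R.
Proof.
split=> [[cs csE]|[q qE]]; last first.
  by exists q => n; rewrite qE horner_coef.
exists (Poly cs) => n; rewrite csE (horner_coef_wide _ (size_Poly cs)).
by apply: eq_bigr => i _; rewrite coef_Poly.
Qed.

Lemma is_polynomial_const k : is_polynomial (fun=> k).
Proof. by apply/is_polynomialP; exists (k%:P)%R => n; rewrite hornerC. Qed.

Lemma is_polynomial_id : is_polynomial id.
Proof. by apply/is_polynomialP; exists ('X)%R => n; rewrite hornerX. Qed.

Lemma is_polynomialD p q :
  is_polynomial p -> is_polynomial q -> is_polynomial (fun n => p n + q n).
Proof.
move=> /is_polynomialP[p' pE] /is_polynomialP[q' qE]; apply/is_polynomialP.
by exists (p' + q')%R => n; rewrite hornerD pE qE.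
Qed.

Lemma is_polynomialM p q :
  is_polynomial p -> is_polynomial q -> is_polynomial (fun n => p n * q n).
Proof.
move=> /is_polynomialP[p' pE] /is_polynomialP[q' qE]; apply/is_polynomialP.
by exists (p' * q')%R => n; rewrite hornerM pE qE.
Qed.

Lemma is_polynomialS p : is_polynomial p -> is_polynomial (fun n => (p n).+1).
Proof.
move/is_polynomialD/(_ (is_polynomial_const 1)) => [cs csE].
by exists cs => n; rewrite -csE addn1.
Qed.

Local Open Scope ring_scope.

(** * Farkas' lemma and barycentric spanners *)

(** Induction on the number of variables. Columns are indexed by [nat] so that the same [a] serves
    [n] and [n.+1], rows by any finite type because elimination replaces them by pairs. *)
Lemma farkas (F : realFieldType) (n : nat) (I : finType)
    (a : I -> nat -> F) (b : I -> F) :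
  (exists x : nat -> F, forall i, \sum_(j < n) a i j * x j <= b i) \/
  (exists u : I -> F, [/\ forall i, 0 <= u i,
     forall j, (j < n)%N -> \sum_i u i * a i j = 0 & \sum_i u i * b i < 0]).
Proof.
elim: n I a b => [|n IHn] I a b.
  case: (boolP [forall i, 0 <= b i]) => [/forallP b0|].
    by left; exists (fun=> 0) => i; rewrite big_ord0.
  rewrite negb_forall => /existsP[i]; rewrite -ltNge => bi.
  right; exists (fun k => (k == i)%:R); split=> //.
  rewrite (bigD1 i) //= eqxx mul1r big1 ?addr0 // => k /negPf->.
  by rewrite mul0r.
pose c i := a i n.
(* Fourier-Motzkin elimination of the last variable; unused row indices carry the zero row. *)
pose W (k : I * I + I) (i : I) : F :=
  match k with
  | inl (p, q) => if (0 < c p) && (c q < 0)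
                  then c p * (i == q)%:R - c q * (i == p)%:R else 0
  | inr p => if c p == 0 then (i == p)%:R else 0
  end.
have W0 k i : 0 <= W k i.
  case: k => [[p q]|p] /=; case: ifP => // /andP[cp cq].
  by rewrite subr_ge0 (@le_trans _ _ 0) ?mulr_ge0 ?ler0n ?(ltW cp) //
    mulr_le0_ge0 ?ler0n // ltW.
have delta (f : I -> F) p : \sum_i (i == p)%:R * f i = f p.
  rewrite (bigD1 p) //= eqxx mul1r big1 ?addr0 // => k /negPf->.
  by rewrite mul0r.
have WE k (f : I -> F) : \sum_i W k i * f i =
  match k with
  | inl (p, q) => if (0 < c p) && (c q < 0) then c p * f q - c q * f p else 0
  | inr p => if c p == 0 then f p else 0
  end.
  case: k => [[p q]|p] /=; case: ifP => _; rewrite ?delta //;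
    try by rewrite big1 // => i _; rewrite mul0r.
  rewrite -(delta f p) -(delta f q) !mulr_sumr -sumrB.
  by apply: eq_bigr => i _; rewrite mulrBl !mulrA.
have [[x Hx]|[u [u0 ua ub]]] :=
    IHn _ (fun k j => \sum_i W k i * a i j) (fun k => \sum_i W k i * b i).
  left.
  (* The slack left to the last variable [t]: the rows demand [c i * t <= s i]. *)
  pose s i := b i - \sum_(j < n) a i j * x j.
  have sW k : 0 <= \sum_i W k i * s i.
    move: (Hx k); rewrite -subr_ge0; congr (_ <= _).
    rewrite /s; under [RHS]eq_bigr do rewrite mulrBr mulr_sumr.
    rewrite sumrB exchange_big /=; congr (_ - _); apply: eq_bigr => j _.
    by rewrite mulr_suml; apply: eq_bigr => i _; rewrite mulrA.
  (* Rows with [c i > 0] bound [t] from above, those with [c i < 0] from below, and [sP] puts each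
     lower bound under each upper one. So [t] is the least upper bound if there is one, else the
     greatest lower bound, else 0. *)
  have [t Ht] : exists t, forall i, c i * t <= s i.
    have sP p q : 0 < c p -> c q < 0 -> s q / c q <= s p / c p.
      move=> cp cq; move: (sW (inl (p, q))); rewrite WE cp cq /= subr_ge0.
      by rewrite ler_ndivrMr // mulrAC ler_pdivrMr // [s p * _]mulrC [s q * _]mulrC.
    have s0 p : c p = 0 -> 0 <= s p.
      by move=> cp; move: (sW (inr p)); rewrite WE cp eqxx.
    have [p0 cp0|noP] := pickP (fun p => 0 < c p).
      case: (@arg_minP _ _ _ p0 (fun p => 0 < c p) (fun p => s p / c p)) => // p cp pmin.
      exists (s p / c p) => i.
      have [ci|ci|ci] := ltgtP (c i) 0; last by rewrite ci mul0r s0.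
        by rewrite mulrC -ler_ndivrMr // sP.
      by rewrite mulrC -ler_pdivlMr //; apply: pmin.
    have [q0 cq0|noQ] := pickP (fun q => c q < 0).
      case: (@arg_maxP _ _ _ q0 (fun q => c q < 0) (fun q => s q / c q)) => // q cq qmax.
      exists (s q / c q) => i.
      have [ci|ci|ci] := ltgtP (c i) 0; last by rewrite ci mul0r s0.
        by rewrite mulrC -ler_ndivrMr //; apply: qmax.
      by move: (noP i) => /=; rewrite ci.
    exists 0 => i; rewrite mulr0 s0 //; apply/eqP.
    by move: (noP i) (noQ i) => /=; case: (ltgtP (c i) 0).
  exists (fun j => if (j < n)%N then x j else t) => i.
  rewrite big_ord_recr /= ltnn -/(c i).
  under eq_bigr do rewrite ltn_ord.
  by rewrite addrC -lerBrDr.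
(* The certificate of the eliminated system is pulled back along [W], whose entries are
   nonnegative. *)
right; exists (fun i => \sum_k u k * W k i); split.
- by move=> i; apply: sumr_ge0 => k _; rewrite mulr_ge0.
- move=> j; rewrite ltnS leq_eqVlt => /orP[/eqP->|jn].
    under eq_bigr do rewrite mulr_suml.
    rewrite exchange_big big1 //= => k _.
    under eq_bigr do rewrite -mulrA.
    rewrite -mulr_sumr WE; case: k => [[p q]|p]; case: ifP => h; rewrite ?mulr0 //.
      by rewrite -/(c q) -/(c p) [c p * _]mulrC subrr mulr0.
    by rewrite -/(c p) (eqP h) mulr0.
  under eq_bigr do rewrite mulr_suml.
  rewrite -[RHS](ua _ jn) exchange_big; apply: eq_bigr => k _ /=.
  by rewrite mulr_sumr; apply: eq_bigr => i _; rewrite mulrA.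
- under eq_bigr do rewrite mulr_suml.
  apply: le_lt_trans ub; rewrite exchange_big le_eqVlt; apply/orP; left; apply/eqP.
  by apply: eq_bigr => k _ /=; rewrite mulr_sumr; apply: eq_bigr => i _; rewrite mulrA.
Qed.

(** Choose the [m] rows whose minor is largest in absolute value: it is nonzero by full rank and
    cannot grow when one row is exchanged. *)
Lemma spanner_full (F : realFieldType) (N m : nat) (C : 'M[F]_(N, m)) :
  row_full C -> exists f : 'I_m -> 'I_N,
  forall i, exists al : 'rV[F]_m,
    (forall j, `|al 0 j| <= 1) /\ row i C = al *m rowsub f C.
Proof.
move=> fullC.
pose D (g : {ffun 'I_m -> 'I_N}) := \det (rowsub g C).
pose g0 := fullrankfun fullC.
have [f _ fmax] := @arg_maxP _ _ _ g0 xpredT (fun g => `|D g|) isT.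
have Df : D f != 0.
  have : D g0 != 0.
    have := fullrowsub_unit fullC; rewrite unitmxE unitfE /D; by [].
  rewrite -!normr_gt0 => D0; exact: lt_le_trans D0 (fmax g0 isT : `|D g0| <= `|D f|).
have fU : rowsub f C \in unitmx by rewrite unitmxE unitfE.
exists f => i.
pose al := row i C *m invmx (rowsub f C).
have alE : row i C = al *m rowsub f C by rewrite /al mulmxKV.
exists al; split => // j.
(* Cramer's rule: [al 0 j] is the ratio of two minors, of which the one at [f] is maximal. *)
pose g := [ffun k => if k == j then i else f k].
have Dg : D g = al 0 j * D f.
  (* The identity with row [j] replaced by [al], of determinant [al 0 j]. *)
  pose E := \matrix_(k, l) (if k == j then al 0 l else (k == l)%:R) : 'M[F]_m.
  have gE : rowsub g C = E *m rowsub f C.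
    apply/row_matrixP => k; rewrite row_mul row_rowsub ffunE.
    have [->|kj] := eqVneq k j.
      rewrite alE; congr (_ *m _); apply/rowP => l.
      by rewrite !mxE eqxx.
    rewrite -row_rowsub (rowE k (rowsub f C)); congr (_ *m _); apply/rowP => l.
    by rewrite !mxE eqxx (negPf kj) eq_sym.
  rewrite /D gE det_mulmx; congr (_ * _).
  rewrite (expand_det_col _ j) (bigD1 j) //= big1 => [|k kj]; last first.
    by rewrite mxE (negPf kj) mul0r.
  rewrite addr0 mxE eqxx /cofactor -signr_odd oddD addbb mul1r.
  rewrite (_ : row' _ _ = 1%:M) ?det1 ?mulr1 //.
  by apply/matrixP => k l; rewrite !mxE eq_sym (negPf (neq_lift _ _)) (inj_eq lift_inj).
have := fmax g isT; rewrite Dg normrM => h.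
by rewrite -(ler_pM2r (_ : 0 < `|D f|)) ?mul1r // normr_gt0.
Qed.

(** The rank factorization [A = col_base A *m row_base A] reduces to full column rank, since
    relations between rows of the first factor carry over to [A]. For empty [T] this gives
    [m = 0]. *)
Lemma barycentric_spanner (F : realFieldType) (T : finType) (d : nat)
    (phi : T -> 'rV[F]_d) :
  exists m (f : 'I_m -> T), (m <= d)%N /\
    forall t, exists al : 'I_m -> F,
      (forall j, `|al j| <= 1) /\ phi t = \sum_j al j *: phi (f j).
Proof.
pose A := \matrix_(i < #|T|) phi (enum_val i).
have [f Hf] := spanner_full (col_base_full A).
exists (\rank A), (enum_val \o f); split; first exact: rank_leq_col.
move=> t; have [al [al1 alE]] := Hf (enum_rank t).
exists (al 0); split => //.
have -> : phi t = row (enum_rank t) A by rewrite rowK enum_rankK.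
rewrite -{1}[A]mulmx_base row_mul alE -mulmxA mul_rowsub_mx mulmx_base.
rewrite mulmx_sum_row; apply: eq_bigr => j _.
by rewrite row_rowsub rowK.
Qed.

Lemma farkas_mx (F : realFieldType) (m n : nat) (A : 'M[F]_(m, n)) (b : 'cV[F]_m) :
  (exists x : 'cV_n, forall i, (A *m x) i 0 <= b i 0) \/
  (exists u : 'rV_m, [/\ forall i, 0 <= u 0 i, u *m A = 0 & (u *m b) 0 0 < 0]).
Proof.
pose a i j := if insub j is Some j' then A i j' else 0.
have aE i (j : 'I_n) : a i j = A i j by rewrite /a valK.
case: (farkas n a (fun i => b i 0)) => [[x Hx]|[u [u0 ua ub]]].
  left; exists (\col_j x j) => i; apply: le_trans (Hx i).
  by rewrite mxE; apply: ler_sum => j _; rewrite aE mxE.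
right; exists (\row_i u i); split => [i||].
- by rewrite mxE.
- apply/rowP => j; rewrite !mxE -[RHS](ua j (ltn_ord j)).
  by apply: eq_bigr => i _; rewrite mxE aE.
- by rewrite mxE; apply: le_lt_trans ub; apply: ler_sum => i _; rewrite mxE.
Qed.

(** * From extended formulations to separated point sets *)

(** Each column of [u] is divided by its maximum, and the factor moves to [v]. A nonzero maximum is
    attained at some [z], where [a k * v x k] is one term of a nonnegative sum that is at most
    [c]. *)
Lemma normalize_factorization (F : realFieldType) (Z : finType) (X : Type)
    (K : nat) (u : Z -> 'I_K -> F) (v : X -> 'I_K -> F) (c : F) :
  (forall z k, 0 <= u z k) -> (forall x k, 0 <= v x k) -> 0 <= c ->
  (forall z x, \sum_k u z k * v x k <= c) ->
  exists (u' : Z -> 'I_K -> F) (v' : X -> 'I_K -> F),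
  [/\ forall z k, 0 <= u' z k <= 1, forall x k, 0 <= v' x k <= c &
      forall z x, \sum_k u' z k * v' x k = \sum_k u z k * v x k].
Proof.
move=> u0 v0 c0 uv.
pose a k := \big[Order.max/0]_z u z k.
have ua z k : u z k <= a k by rewrite /a (bigD1 z) //= le_max lexx.
have a0 k : 0 <= a k.
  by rewrite /a; elim/big_ind: _ => // x y; rewrite le_max => ->.
(* The value 0 covers an empty [Z] and zero columns; division by it yields 0, as wanted. *)
have aP k : a k = 0 \/ exists z, a k = u z k.
  rewrite /a; elim/big_ind: _ => [|x y hx hy|z _]; [by left| |by right; exists z].
  by case: leP.
exists (fun z k => u z k / a k), (fun x k => a k * v x k); split.
- move=> z k; rewrite divr_ge0 //=.
  have [a_eq0|a_neq0] := eqVneq (a k) 0; first by rewrite a_eq0 invr0 mulr0.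
  by rewrite ler_pdivrMr ?mul1r // lt_def a_neq0 a0.
- move=> x k; rewrite mulr_ge0 //=.
  have [->|[z ->]] := aP k; first by rewrite mul0r.
  apply: le_trans (uv z x); rewrite (bigD1 k) //= lerDl sumr_ge0 // => i _.
  by rewrite mulr_ge0.
- move=> z x; apply: eq_bigr => k _.
  have [a_eq0|a_neq0] := eqVneq (a k) 0; last by rewrite mulrA divfK.
  suff -> : u z k = 0 by rewrite !mul0r.
  by apply/eqP; rewrite eq_le u0 -a_eq0 ua.
Qed.

Definition hamming (n : nat) (z x : seq bool) : nat :=
  (\sum_(i < n) (nth false z i (+) nth false x i))%N.

Lemma hamming_self n z : hamming n z z = 0%N.
Proof. by rewrite /hamming big1 // => i _; rewrite addbb. Qed.

Lemma hamming_gt0 n (z x : n.-tuple bool) : z != x -> (0 < hamming n z x)%N.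
Proof.
move=> zx; rewrite lt0n; apply: contraNneq zx => /eqP; rewrite sum_nat_eq0 => /forallP h.
apply/eqP/eq_from_tnth => i; move: (h i); rewrite /= -!tnth_nth.
by case: (tnth z i); case: (tnth x i).
Qed.

Lemma hamming_le n z x : (hamming n z x <= n)%N.
Proof.
rewrite -[X in (_ <= X)%N]card_ord -sum1_card; apply: leq_sum => i _.
by case: addb.
Qed.

Definition bit (b : bool) : R := if b then 1 else 0.

(** On bits, z xor x equals z + (1 - 2 z) x, which is affine in x. *)
Lemma hamming_linear n (z x : n.-tuple bool) :
  (hamming n z x)%:R = \sum_i bit (tnth z i) + ((\row_i (1 - 2 * bit (tnth z i))) *m bitvec x) 0 0 :> R.
Proof.
rewrite /hamming natr_sum mxE -big_split; apply: eq_bigr => i _.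
by rewrite -!tnth_nth !mxE /bit; case: (tnth z i); case: (tnth x i) => /=; ring.
Qed.

(* The last factor, with [v = 1], carries the constant term of the affine Farkas certificate. *)
Lemma slack_factorization (L : language) (n p : nat) (A : 'M[R]_(p, n))
    (B : 'M[R]_(p, p)) (b : 'cV[R]_p) (x0 : n.-tuple bool) :
  (forall x : 'cV[R]_n, conv_slice L x <->
     exists y : 'cV[R]_p, forall i, (A *m x + B *m y) i 0 <= b i 0) ->
  L x0 ->
  exists (u : {z : n.-tuple bool | `[< ~ L z >]} -> 'I_(p + 1) -> R)
         (v : {x : n.-tuple bool | L x} -> 'I_(p + 1) -> R),
  [/\ forall z k, 0 <= u z k, forall x k, 0 <= v x k &
      forall z x, \sum_k u z k * v x k = 2 * (hamming n (sval z) (sval x))%:R - 1].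
Proof.
move=> LP Lx0.
have slice x : L (tval x) -> exists y : 'cV[R]_p, forall i,
    (A *m bitvec x + B *m y) i 0 <= b i 0.
  move=> Lx; apply/LP; exists [ffun t => (t == x)%:R]; split; last split; last split.
  - by move=> t; rewrite ffunE ler0n.
  - by move=> t nL; rewrite ffunE; case: eqP => // tx; case: nL; rewrite tx.
  - rewrite (bigD1 x) //= ffunE eqxx big1 ?addr0 // => t /negPf tx.
    by rewrite ffunE tx.
  - rewrite (bigD1 x) //= ffunE eqxx scale1r big1 ?addr0 // => t /negPf tx.
    by rewrite ffunE tx scale0r.
pose c (z : n.-tuple bool) : 'rV[R]_n := \row_i (1 - 2 * bit (tnth z i)).
pose s (z : n.-tuple bool) : R := \sum_i bit (tnth z i).
(* Multipliers that derive H(z, x) >= 1/2 from the formulation: they give H(z, x) - 1/2 = w.1 (b - A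
   x - B y) + w.2. *)
have cert (z : {z : n.-tuple bool | `[< ~ L z >]}) : exists w : 'rV[R]_p * R,
    [/\ forall i, 0 <= w.1 0 i, 0 <= w.2, w.1 *m A = - c (sval z), w.1 *m B = 0 &
        (w.1 *m b) 0 0 + w.2 = s (sval z) - 2^-1].
  case: z => z /= /asboolP nLz.
  (* The added row says H(z, x) <= 1/2. A solution x would be a convex combination of members of L,
     all at distance at least 1 from z. *)
  have [[xy Hxy]|] := farkas_mx (block_mx A B (c z) 0)
     (col_mx b (2^-1 - s z)%:M : 'cV_(p + 1)).
    exfalso.
    pose x := usubmx xy; pose y := dsubmx xy.
    have xyE : block_mx A B (c z) 0 *m xy = col_mx (A *m x + B *m y) (c z *m x).
      by rewrite -{1}[xy]vsubmxK mul_block_col mul0mx addr0.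
    rewrite xyE in Hxy.
    have : conv_slice L x.
      by apply/LP; exists y => i; move: (Hxy (lshift 1 i)); rewrite !col_mxEu.
    case=> w [w0 [wL [w1 xE]]].
    have := Hxy (rshift p 0); rewrite !col_mxEd [X in _ <= X]mxE eqxx mulr1n xE mulmx_sumr summxE.
    have sE : s z = \sum_t s z * w t by rewrite -mulr_sumr w1 mulr1.
    rewrite lerBrDr sE -big_split /=.
    apply/negP; rewrite -ltNge; apply: (@lt_le_trans _ _ 1); first by lra.
    rewrite -{1}w1; apply: ler_sum => t _.
    rewrite -scalemxAr mxE mulrC -mulrDl addrC -hamming_linear.
    have [Lt|nLt] := pselect (L t); last by rewrite wL // mulr0.
    rewrite -{1}[w t]mul1r ler_wpM2r // ler1n hamming_gt0 //.
    by apply: contra_notN nLz => /eqP->.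
  move=> [w [w0 wM wb]].
  have wE := hsubmxK w.
  set u := lsubmx w in wE; set t := rsubmx w in wE.
  rewrite -wE mul_row_block mulmx0 addr0 in wM.
  have /eq_row_mx[uA uB] : row_mx (u *m A + t *m c z) (u *m B) = row_mx 0 0 :> 'rV_(n + p).
    by rewrite row_mx0.
  rewrite -wE mul_row_col mxE [t *m _]mul_mx_scalar in wb.
  have u0 i : 0 <= u 0 i by rewrite mxE.
  have t0 : 0 <= t 0 0 by rewrite mxE.
  rewrite {1}[t]mx11_scalar mul_scalar_mx in uA.
  (* With [t = 0] the certificate would refute A x + B y <= b itself, which is solvable at [x0]. *)
  have tpos : 0 < t 0 0.
    rewrite lt_def t0 andbT; apply/eqP => t_eq0.
    rewrite t_eq0 scale0r addr0 in uA.
    have [y Hy] := slice x0 Lx0.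
    move: wb; rewrite [X in _ + X]mxE t_eq0 mulr0 addr0; apply/negP; rewrite -leNgt.
    suff -> : 0 = (u *m (A *m bitvec x0 + B *m y)) 0 0.
      by rewrite !mxE; apply: ler_sum => i _; rewrite ler_wpM2l.
    by rewrite mulmxDr !mulmxA uA uB !mul0mx addr0 mxE.
  (* Scaling gives the row of H the coefficient 1; the second component is the gap left in the
     Farkas inequality. *)
  exists ((t 0 0)^-1 *: u, s z - 2^-1 - (t 0 0)^-1 * (u *m b) 0 0) => /=.
  have ti : 0 <= (t 0 0)^-1 by rewrite invr_ge0.
  split.
  - by move=> i; rewrite mxE mulr_ge0.
  - have : (t 0 0)^-1 * ((u *m b) 0 0 + (2^-1 - s z) * t 0 0) <= 0.
      by rewrite mulr_ge0_le0 // ltW //; move: wb; rewrite [X in _ + X]mxE.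
    rewrite mulrDr mulrCA mulVf ?mulr1 ?gt_eqF //; lra.
  - rewrite -scalemxAl; apply/eqP; rewrite -addr_eq0; apply/eqP.
    by rewrite -[c z](scalerK (lt0r_neq0 tpos)) -scalerDr uA scaler0.
  - by rewrite -scalemxAl uB scaler0.
  - by rewrite -scalemxAl mxE; lra.
have [w wP] := choice cert.
have [y yP] : {y : {x : n.-tuple bool | L x} -> 'cV[R]_p & forall x i,
    (A *m bitvec (sval x) + B *m y x) i 0 <= b i 0}.
  apply: (@choice _ _ (fun x y => forall i,
    (A *m bitvec (sval x) + B *m y) i 0 <= b i 0)) => -[x Lx]; exact: slice.
pose sl x := b - (A *m bitvec (sval x) + B *m y x).
exists (fun z k => 2 * row_mx (w z).1 (w z).2%:M 0 k), (fun x k => col_mx (sl x) 1%:M k 0).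
have row0 (z : {z : n.-tuple bool | `[< ~ L z >]}) : forall k, 0 <= row_mx (w z).1 (w z).2%:M 0 k.
  move=> k; have [w0 w1 _ _ _] := wP z; rewrite mxE; case: splitP => // j _.
  by rewrite mxE ord1 eqxx mulr1n.
split.
- by move=> z k; rewrite mulr_ge0.
- move=> x k; rewrite mxE; case: splitP => j _; last by rewrite mxE ord1 eqxx.
  by rewrite !mxE subr_ge0; move: (yP x j); rewrite !mxE.
- move=> z x; have [_ _ wA wB wb] := wP z.
  have -> : \sum_k 2 * row_mx (w z).1 (w z).2%:M 0 k * col_mx (sl x) 1%:M k 0 =
     2 * (row_mx (w z).1 (w z).2%:M *m col_mx (sl x) 1%:M) 0 0.
    by rewrite mxE mulr_sumr; apply: eq_bigr => k _; rewrite mulrA.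
  rewrite mul_row_col mulmx1 mxE [X in _ + X]mxE eqxx mulr1n.
  rewrite mulmxBr mulmxDr !mulmxA wA wB mul0mx addr0 mulNmx opprK.
  rewrite [X in X + _]mxE hamming_linear -/(c _) -/(s _); lra.
Qed.

(** The perceptron works on families indexed by [nat]; those indexed by ordinals are continued by a
    default. *)
Definition extend (T : Type) (d : T) (n : nat) (f : 'I_n -> T) (i : nat) : T :=
  if insub i is Some i' then f i' else d.

Lemma extendE (T : Type) (d : T) n (f : 'I_n -> T) (i : 'I_n) : extend d f i = f i.
Proof. by rewrite /extend valK. Qed.

Lemma extend_ind (T : Type) (Q : T -> Prop) (d : T) n (f : 'I_n -> T) i :
  Q d -> (forall i, Q (f i)) -> Q (extend d f i).
Proof. by move=> Qd Qf; rewrite /extend; case: insub => [j|]. Qed.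

(** For x in L, the factorization makes a combination of the unrounded points vanish. For x outside
    L, the spanner coefficients of x itself turn the [a] part into Q V u_k(x) >= 0 and the offsets
    into -Q, the value at z = x. Rounding costs at most 1 for each coordinate. *)
Lemma threshold_points (L : language) (n p : nat) (A : 'M[R]_(p, n))
    (B : 'M[R]_(p, p)) (b : 'cV[R]_p) (x0 : n.-tuple bool) (Q : nat) :
  (forall x : 'cV[R]_n, conv_slice L x <->
     exists y : 'cV[R]_p, forall i, (A *m x + B *m y) i 0 <= b i 0) ->
  L x0 ->
  exists (m : nat) (zs : nat -> seq bool) (a : nat -> nat -> int),
  [/\ (m <= n + 1 + (p + 1))%N,
      forall k j, 0 <= a k j <= (Q * ((p + 1) * (2 * n.+1)))%N%:Z &
  forall x : seq bool, size x = n ->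
  let P k j := a k j - Q%:Z * (2 * (hamming n (zs j) x)%:Z - 1) in
  (L x -> exists lam : nat -> R, [/\ forall k, 0 <= lam k,
      \sum_(k < p.+2) lam k = 1 &
      forall j, (j < m)%N -> `|\sum_(k < p.+2) lam k * (P k j)%:~R| <= 1]) /\
  (~ L x -> exists al : nat -> R, (forall j, `|al j| <= 1) /\
      forall k, (k < p.+2)%N ->
        Q%:R - m%:R <= \sum_(j < m) al j * (P k j)%:~R)].
Proof.
move=> LP Lx0.
have [u1 [v1 [u10 v10 uv1]]] := slack_factorization LP Lx0.
have [z x|u [v [u01 v01 uv']]] :=
    @normalize_factorization _ _ _ _ u1 v1 (2 * n.+1)%:R u10 v10 (ler0n _ _).
  rewrite uv1 lerBlDr natrM -[X in _ <= X]addr0 -natr1.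
  have := hamming_le n (sval z) (sval x); rewrite -(ler_nat R); lra.
have uv z x : \sum_k u z k * v x k = 2 * (hamming n (sval z) (sval x))%:R - 1.
  by rewrite uv' uv1.
(* [V] bounds the sum of the p + 1 numbers v_k(x), so the v_k(x) / V are weights of total at most
   1. *)
pose V : nat := ((p + 1) * (2 * n.+1))%N.
have V0 : (0 < V)%N by rewrite /V addn1 muln_gt0.
(* The columns [z] and [1] make [2 H(z, x) - 1] a linear function of the row of [z]. *)
pose phi (z : {z : n.-tuple bool | `[< ~ L z >]}) : 'rV[R]_(n + 1 + (p + 1)) :=
  row_mx (row_mx (\row_i bit (tnth (sval z) i)) 1%:M) (\row_k u z k).
have [m [f [mle spanf]]] := barycentric_spanner phi.
pose aa (k : 'I_(p + 1)) (j : 'I_m) : int := Num.floor ((Q * V)%N%:R * u (f j) k).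
have aa0 k j : 0 <= aa k j <= (Q * V)%N%:Z.
  have /andP[ge0 le1] := u01 (f j) k.
  rewrite /aa floor_ge0 mulr_ge0 //= -(ler_int R).
  apply: le_trans (floor_le _) _.
  by rewrite -[X in _ <= X]mulr1 ler_wpM2l.
have aaP k j : 0 <= (Q * V)%N%:R * u (f j) k - (aa k j)%:~R <= 1.
  by have := floor_itv ((Q * V)%N%:R * u (f j) k); rewrite -/(aa k j) rmorphD /=; lra.
pose zs := extend [::] (fun j => tval (sval (f j))).
pose a k := extend 0 (fun j => extend 0 (fun k' => aa k' j) k).
exists m, zs, a; split => //.
  move=> k j; rewrite /a; apply: (@extend_ind _ (fun a : int => 0 <= a <= (Q * V)%N%:Z)) => [|{}j].
    by rewrite lexx.
  by apply: (@extend_ind _ (fun a : int => 0 <= a <= (Q * V)%N%:Z)) => [|{}k] //; rewrite lexx.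
move=> x sx P.
have aE (k : 'I_(p + 1)) (j : 'I_m) : a k j = aa k j by rewrite /a !extendE.
(* The extra point of index p + 1 has [a = 0] by default; it takes the weight missing from 1. *)
have aN (j : 'I_m) : a (p + 1)%N j = 0.
  by rewrite /a extendE /extend insubF // ltnn.
have p2 : p.+2 = (p + 1).+1 by rewrite addn1.
rewrite p2; split => [Lx|nLx].
  pose xt : n.-tuple bool := Tuple (introT eqP sx).
  have Lxt : L xt by [].
  pose X : {x : n.-tuple bool | L x} := exist _ xt Lxt.
  have lV k : 0 <= v X k / V%:R by rewrite divr_ge0 //; case/andP: (v01 X k).
  have sV : \sum_k v X k / V%:R <= 1.
    rewrite -mulr_suml ler_pdivrMr ?ltr0n // mul1r /V natrM mulrC mulr_natr -[X in _ *+ X]card_ord -sumr_const.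
    by apply: ler_sum => k _; case/andP: (v01 X k).
  pose lam := extend (1 - \sum_k v X k / V%:R) (fun k => v X k / V%:R).
  have lamN : lam (p + 1)%N = 1 - \sum_k v X k / V%:R.
    by rewrite /lam /extend insubF // ltnn.
  have lamE (k : 'I_(p + 1)) : lam k = v X k / V%:R by rewrite /lam extendE.
  have lam0 k : 0 <= lam k.
    by apply: (@extend_ind _ (fun y => 0 <= y)) => //; rewrite subr_ge0.
  have lam1 : \sum_(k < (p + 1).+1) lam k = 1.
    rewrite big_ord_recr /= lamN; under eq_bigr do rewrite lamE.
    by rewrite addrC subrK.
  exists lam; split=> // j jm.
  have [j' ->] : exists j' : 'I_m, j = j' by exists (Ordinal jm).
  (* By the factorization only the rounding errors remain. *)
  have -> : \sum_(k < (p + 1).+1) lam k * (P k j')%:~R =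
      - \sum_(k < p + 1) lam k * ((Q * V)%N%:R * u (f j') k - (aa k j')%:~R).
    rewrite /P; under eq_bigr do rewrite rmorphB mulrBr.
    rewrite sumrB -mulr_suml lam1 mul1r big_ord_recr /= aN mulr0 addr0.
    have uvj : \sum_(k < p + 1) lam k * ((Q * V)%N%:R * u (f j') k) =
        Q%:R * (2 * (hamming n (zs j') x)%:R - 1).
      rewrite /zs extendE -(uv (f j') X) mulr_sumr; apply: eq_bigr => k _.
      rewrite lamE natrM; have V0' : V%:R != 0 :> R by rewrite pnatr_eq0 -lt0n.
      by field.
    under [X in _ = - X]eq_bigr do rewrite mulrBr.
    rewrite sumrB uvj opprB; congr (_ - _); last by rewrite rmorphM rmorphB rmorphM.
    by apply: eq_bigr => k _; rewrite aE.
  rewrite normrN ger0_norm; last first.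
    by apply: sumr_ge0 => k _; rewrite mulr_ge0 //; case/andP: (aaP k j').
  apply: (@le_trans _ _ (\sum_(k < p + 1) lam k)).
    apply: ler_sum => k _; rewrite -[X in _ <= X]mulr1 ler_wpM2l //.
    by case/andP: (aaP k j').
  by rewrite -lam1 big_ord_recr /= lerDl.
pose xt : n.-tuple bool := Tuple (introT eqP sx).
have nLxt : `[< ~ L xt >] by apply/asboolP.
pose X : {z : n.-tuple bool | `[< ~ L z >]} := exist _ xt nLxt.
have [al [al1 alE]] := spanf X.
have uE k : u X k = \sum_j al j * u (f j) k.
  have := congr1 (fun M : 'rV[R]_(n + 1 + (p + 1)) => M 0 (rshift (n + 1) k)) alE; rewrite row_mxEr mxE summxE => ->.
  by apply: eq_bigr => j _; rewrite mxE row_mxEr mxE.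
(* By linearity in the row of z, this is 2 H(x, x) - 1. *)
have hE : \sum_j al j * (2 * (hamming n (zs j) x)%:R - 1) = -1.
  pose g : 'cV[R]_(n + 1 + (p + 1)) := col_mx (col_mx (\col_i (2 - 4 * bit (tnth xt i)))
    (2 * (\sum_i bit (tnth xt i)) - 1)%:M) 0.
  have gE z : (phi z *m g) 0 0 = 2 * (hamming n (sval z) xt)%:R - 1.
    rewrite !mul_row_col mulmx0 addr0 mul1mx mxE [X in _ + X]mxE eqxx mulr1n addrA.
    rewrite hamming_linear mulrDr !mxE; congr (_ - _).
    rewrite !mulr_sumr -!big_split; apply: eq_bigr => i _ /=.
    by rewrite !mxE /bit; case: (tnth xt i); case: (tnth (sval z) i) => /=; ring.
  transitivity ((phi X *m g) 0 0); last by rewrite gE hamming_self mulr0 add0r.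
  rewrite alE mulmx_suml summxE; apply: eq_bigr => j _.
  rewrite -scalemxAl mxE gE /zs extendE. by [].
exists (extend 0 al); split.
  by move=> j; apply: (@extend_ind _ (fun y => `|y| <= 1)) => //; rewrite normr0.
move=> k; rewrite /P => kp.
have -> : \sum_(j < m) extend 0 al j * (a k j - Q%:Z * (2 * (hamming n (zs j) x)%:Z - 1))%:~R =
   \sum_(j < m) al j * (a k j)%:~R + Q%:R.
  rewrite -[X in _ + X]mulr1 -[X in _ * X]opprK -hE mulrN mulr_sumr -sumrB.
  apply: eq_bigr => j _; rewrite extendE rmorphB !rmorphM rmorphB rmorphM /=.
  by rewrite mulrBr; congr (_ - _); rewrite mulrCA.
rewrite addrC lerD2r.
move: kp; rewrite ltnS leq_eqVlt => /orP[/eqP->|kp].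
  rewrite big1 ?oppr_le0 // => j _.
  by rewrite aN mulr0.
have [k' ->] : exists k' : 'I_(p + 1), k = k' by exists (Ordinal kp).
have -> : \sum_(j < m) al j * (a k' j)%:~R = (Q * V)%N%:R * u X k' -
     \sum_(j < m) al j * ((Q * V)%N%:R * u (f j) k' - (aa k' j)%:~R).
  rewrite uE mulr_sumr -sumrB; apply: eq_bigr => j _; rewrite aE; ring.
have : \sum_(j < m) al j * ((Q * V)%N%:R * u (f j) k' - (aa k' j)%:~R) <= m%:R.
  rewrite -[X in _ <= X%:R]card_ord -sumr_const; apply: ler_sum => j _.
  apply: le_trans (ler_norm _) _; rewrite normrM mulr_ile1 //.
  by have /andP[h1 h2] := aaP k' j; rewrite ger0_norm.
have : 0 <= (Q * V)%N%:R * u X k' by rewrite mulr_ge0 //; case/andP: (u01 X k').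
lra.
Qed.

(** * The perceptron algorithm *)

(** The default [d] signals failure. The recursion is a fold with one test for each step, the form
    in which the circuit computes it. *)
Fixpoint select (test : nat -> bool) (d k : nat) : nat :=
  if k is k'.+1 then if test k' then k' else select test d k' else d.

Lemma eq_select (t1 t2 : nat -> bool) d k :
  t1 =1 t2 -> select t1 d k = select t2 d k.
Proof. by move=> t12; elim: k => //= k ->; rewrite t12. Qed.

Lemma select_test test d k : (select test d k < d)%N -> test (select test d k).
Proof. by elim: k => [|k IH] /=; [rewrite ltnn | case: ifP]. Qed.

Lemma select_lt (test : nat -> bool) d k i :
  (k <= d)%N -> (i < k)%N -> test i -> (select test d k < d)%N.
Proof.
elim: k => [|k IH] //= kd; rewrite ltnS leq_eqVlt => /orP[/eqP-> -> //|ik ti].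
by case: ifP => // _; apply: IH => //; apply: ltnW.
Qed.

Lemma select_le test d k : (k <= d)%N -> (select test d k <= d)%N.
Proof. by elim: k => [|k IH] //= kd; case: ifP => _; [exact: ltnW | apply/IH/ltnW]. Qed.

Section Perceptron.
Variables (m K : nat) (P : nat -> nat -> int) (theta : int).

Definition dot (p w : nat -> int) : int := \sum_(j < m) p j * w j.

Definition choose_point (w : nat -> int) : nat :=
  select (fun k => dot (P k) w <= theta) K K.

(* Once no point is eligible the weights no longer change, so that success of the
   last choice means success of all of them. *)
Fixpoint perceptron (t : nat) : nat -> int :=
  if t is t'.+1 then
    let w := perceptron t' in
    fun j => w j + (if (choose_point w < K)%N then P (choose_point w) j else 0)
  else fun=> 0.

Variable rho : nat.
Hypothesis Prho : forall k j, (k < K)%N -> (j < m)%N -> `|P k j| <= rho%:Z.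

Lemma perceptron_bound t j : (j < m)%N -> `|perceptron t j| <= (t * rho)%:Z.
Proof.
move=> jm; elim: t => [|t IH] /=; first by rewrite normr0.
apply: le_trans (ler_normD _ _) _; rewrite mulSn addnC PoszD lerD //.
by case: ifP => [/Prho/(_ jm)//|_]; rewrite normr0.
Qed.

(** The combination lies in the unit cube and the weights are at most [T * rho], so its product with
    them is at most [theta]. As an average of the products of the points, it would exceed [theta] if
    all of these did. *)
Lemma perceptron_complete (F : realFieldType) (lam : nat -> F) T :
  (forall k, 0 <= lam k) -> \sum_(k < K) lam k = 1 ->
  (forall j, (j < m)%N -> `|\sum_(k < K) lam k * (P k j)%:~R| <= 1) ->
  (m * (T * rho))%:Z <= theta -> (choose_point (perceptron T) < K)%N.
Proof.
move=> lam0 lam1 lamP th; set w := perceptron T.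
case: (boolP [exists k : 'I_K, dot (P k) w <= theta]) => [/existsP[k kP]|].
  exact: (select_lt (leqnn K) (ltn_ord k) kP).
rewrite negb_exists => /forallP far.
suff : (theta%:~R : F) < theta%:~R by rewrite ltxx.
have key : \sum_(k < K) lam k * (dot (P k) w)%:~R <= (theta%:~R : F).
  have -> : \sum_(k < K) lam k * (dot (P k) w)%:~R =
      \sum_(j < m) (\sum_(k < K) lam k * (P k j)%:~R) * (w j)%:~R :> F.
    under eq_bigr do rewrite /dot rmorph_sum mulr_sumr.
    rewrite exchange_big; apply: eq_bigr => j _; rewrite mulr_suml.
    by apply: eq_bigr => k _; rewrite rmorphM mulrA.
  apply: (@le_trans _ _ ((m * (T * rho))%N%:Z%:~R)); last by rewrite ler_int.
  have -> : (m * (T * rho))%N%:Z%:~R = \sum_(j < m) (T * rho)%N%:Z%:~R :> F.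
    by rewrite sumr_const card_ord -mulr_natl PoszM intrM.
  apply: ler_sum => j _; apply: le_trans (ler_norm _) _; rewrite normrM.
  rewrite -[X in _ <= X]mul1r ler_pM ?lamP // -intr_norm.
  by rewrite ler_int perceptron_bound.
apply: lt_le_trans key.
have -> : theta%:~R = \sum_(k < K) lam k * theta%:~R :> F by rewrite -mulr_suml lam1 mul1r.
have far' (k : 'I_K) : lam k * theta%:~R <= lam k * (dot (P k) w)%:~R.
  by rewrite ler_wpM2l // ler_int ltW // ltNge.
(* The comparison is strict: equality would make every [lam k] zero, against their sum 1. *)
rewrite lt_neqAle; apply/andP; split; last by apply: ler_sum => k _; exact: far'.
apply/negP => /eqP eqs.
have : \sum_(k < K) lam k * (dot (P k) w - theta)%:~R = 0.
  under eq_bigr do rewrite rmorphB mulrBr.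
  by rewrite sumrB eqs subrr.
move/eqP; rewrite psumr_eq0 => [/allP h|k _]; last first.
  by rewrite mulr_ge0 // ler0z subr_ge0 ltW // ltNge.
have : \sum_(k < K) lam k = 0.
  rewrite big1 // => k _; have := h k (mem_index_enum _) => /=.
  rewrite mulf_eq0 => /orP[/eqP//|]; rewrite intr_eq0 subr_eq0 => /eqP eqt.
  by have := far k; rewrite eqt lexx.
by rewrite lam1 => /eqP; rewrite oner_eq0.
Qed.

Lemma perceptron_stuck t : (choose_point (perceptron t.+1) < K)%N ->
  (choose_point (perceptron t) < K)%N.
Proof.
move=> h; apply: contraT => stuck; move: h; rewrite -(negPf stuck).
congr (_ < _)%N; rewrite /choose_point.
have E j : perceptron t.+1 j = perceptron t j by rewrite /= (negPf stuck) addr0.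
have D k : dot (P k) (perceptron t.+1) = dot (P k) (perceptron t).
  by apply: eq_bigr => j _; rewrite E.
by apply: eq_select => k; rewrite D.
Qed.

(** Success at [T] means that every round added a point. Each raises the squared norm by 2 w.P +
    |P|^2, where w.P is at most [theta] by the choice of P; [c] counts how often each point was
    added. *)
Lemma perceptron_sound T : 0 <= theta -> (choose_point (perceptron T) < K)%N ->
  \sum_(j < m) perceptron T j ^+ 2 <= T%:Z * (m%:Z * rho%:Z ^+ 2 + 2 * theta) /\
  exists c : nat -> nat, (\sum_(k < K) c k = T)%N /\
    forall j, perceptron T j = \sum_(k < K) (c k)%:Z * P k j.
Proof.
move=> th0; elim: T => [|T IH] hT.
  split; first by rewrite mul0r big1 // => j _; rewrite expr0n.
  exists (fun=> 0%N); split; first by rewrite big1.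
  by move=> j; rewrite big1 // => k _; rewrite mul0r.
have hT' := perceptron_stuck hT; have [norm [c [cT cP]]] := IH hT'.
set w := perceptron T in hT' norm cP *; set k0 := choose_point w in hT' *.
have E j : perceptron T.+1 j = w j + P k0 j by rewrite /= -/w -/k0 hT'.
split.
  under eq_bigr do rewrite E sqrrD.
  rewrite !big_split /=.
  have h1 : \sum_(j < m) w j * P k0 j <= theta.
    have := select_test hT'; rewrite -/k0; apply: le_trans.
    by apply: ler_sum => j _; rewrite mulrC.
  have h2 : \sum_(j < m) P k0 j ^+ 2 <= m%:Z * rho%:Z ^+ 2.
    have -> : m%:Z * rho%:Z ^+ 2 = \sum_(j < m) rho%:Z ^+ 2.
      by rewrite sumr_const card_ord -mulr_natl natz.
    apply: ler_sum => j _.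
    by rewrite -[P k0 j ^+ 2]ger0_norm ?sqr_ge0 // normrX lerXn2r ?nnegrE // Prho.
  rewrite intS mulrDl mul1r; move: norm h1 h2; lra.
exists (fun k => c k + (k == k0))%N; split.
  rewrite big_split /= cT (bigD1 (Ordinal hT')) //= eqxx big1 ?addn0 ?addn1 // => k.
  by rewrite -val_eqE /= => /negPf->.
move=> j; rewrite E cP; under [RHS]eq_bigr do rewrite PoszD mulrDl.
rewrite big_split /=; congr (_ + _).
rewrite (bigD1 (Ordinal hT')) //= eqxx mul1r big1 ?addr0 // => k.
by rewrite -val_eqE /= => /negPf->; rewrite mul0r.
Qed.
End Perceptron.

(** The functional [al] forces the sum of the |w_j| to be at least T (Q - m) >= T Q / 2, with square
    at least 4 N^2 r Q T^2. The squared norm is at most 3 N T^2 Q r, so Cauchy-Schwarz allows only 3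
    N^2 r Q T^2. The factor 16 in [Q] makes these bounds incompatible. *)
Lemma perceptron_separated (F : realFieldType) (m N K r Q T : nat)
    (P : nat -> nat -> int) (theta : int) (al : nat -> F) :
  (m <= N)%N -> (0 < N)%N -> (0 < r)%N ->
  Q = (16 * N ^ 2 * r)%N -> T = (Q * r)%N ->
  theta = (m * (T * (Q * r)))%N%:Z ->
  (forall k j, (k < K)%N -> (j < m)%N -> `|P k j| <= (Q * r)%N%:Z) ->
  (forall j, `|al j| <= 1) ->
  (forall k, (k < K)%N -> Q%:R - m%:R <= \sum_(j < m) al j * (P k j)%:~R) ->
  (choose_point m K P theta (perceptron m K P theta T) < K)%N -> False.
Proof.
move=> mN N0 r0 QE TE thE Prho al1 alP hT.
have th0 : 0 <= theta by rewrite thE.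
have [norm [c [cT cP]]] := perceptron_sound Prho th0 hT.
set w := perceptron m K P theta T in norm cP.
(* AM-GM weight [T Q / (2 N)] in [2 lam |w_j| <= w_j^2 + lam^2]. *)
pose lam : F := (8 * N * r ^ 2 * Q)%N%:R.
have lower : T%:R * (Q%:R - m%:R) <= \sum_(j < m) `|(w j)%:~R : F|.
  apply: (@le_trans _ _ (\sum_(j < m) al j * (w j)%:~R)); last first.
    apply: ler_sum => j _; apply: le_trans (ler_norm _) _.
    by rewrite normrM ler_piMl.
  have -> : \sum_(j < m) al j * (w j)%:~R =
      \sum_(k < K) (c k)%:R * (\sum_(j < m) al j * (P k j)%:~R) :> F.
    under [RHS]eq_bigr do rewrite mulr_sumr.
    rewrite exchange_big; apply: eq_bigr => j _.
    rewrite cP rmorph_sum mulr_sumr; apply: eq_bigr => k _.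
    by rewrite rmorphM mulrCA.
  rewrite -cT natr_sum mulr_suml; apply: ler_sum => k _.
  by rewrite ler_wpM2l // alP.
have upper : 2 * lam * \sum_(j < m) `|(w j)%:~R : F| <=
    (\sum_(j < m) w j ^+ 2)%:~R + m%:R * lam ^+ 2.
  have -> : m%:R * lam ^+ 2 = \sum_(j < m) lam ^+ 2 by rewrite sumr_const card_ord mulr_natl.
  rewrite rmorph_sum -big_split mulr_sumr; apply: ler_sum => j _ /=.
  rewrite rmorphXn /= -[X in _ <= X + _]real_normK ?num_real //.
  rewrite -subr_ge0; set y := `|_|.
  have -> : y ^+ 2 + lam ^+ 2 - 2 * lam * y = (y - lam) ^+ 2 by ring.
  exact: sqr_ge0.
have normF : (\sum_(j < m) w j ^+ 2)%:~R <=
    T%:R * (m%:R * (Q%:R * r%:R) ^+ 2 + 2 * (m%:R * (T%:R * (Q%:R * r%:R)))) :> F.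
  apply: le_trans (_ : (T%:Z * (m%:Z * (Q * r)%N%:Z ^+ 2 + 2 * theta))%:~R <= _).
    by rewrite ler_int.
  by rewrite thE !(rmorphM, rmorphD, rmorphXn, PoszM) /=.
have TF : T%:R = Q%:R * r%:R :> F by rewrite TE natrM.
have QF : Q%:R = 16 * N%:R ^+ 2 * r%:R :> F by rewrite QE !natrM; ring.
have lamF : lam = 8 * N%:R * r%:R ^+ 2 * Q%:R by rewrite /lam !natrM; ring.
have N1 : 1 <= N%:R :> F by rewrite ler1n.
have r1 : 1 <= r%:R :> F by rewrite ler1n.
have mF : m%:R <= N%:R :> F by rewrite ler_nat.
have m0 : 0 <= m%:R :> F by [].
(* Casts and sums become variables of [F], leaving polynomial inequalities. *)
move: (N%:R : F) (r%:R : F) (m%:R : F) (Q%:R : F) (T%:R : F) lower upper normF TF QF lamF N1 r1 mF m0.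
move: (\sum_(j < m) _ : F) ((\sum_(j < m) _)%:~R : F) => S W n' r' m' Q' T'.
move: lam => l lower upper normF TF QF lamF N1 r1 mF m0.
have Q2 : 2 * n' <= Q' by rewrite QF; nra.
have Qp : 0 < Q' by lra.
have lp : 0 < l by rewrite lamF; rewrite !mulr_gt0 ?exprn_gt0 //; lra.
have Tp : 0 < T' by rewrite TF mulr_gt0 //; lra.
have h1 : l * (T' * Q') <= 2 * l * S.
  apply: le_trans (_ : 2 * l * (T' * (Q' - m')) <= _); last by rewrite ler_wpM2l //; lra.
  have -> : 2 * l * (T' * (Q' - m')) = l * (T' * (2 * Q' - 2 * m')) by ring.
  by rewrite (ler_wpM2l (ltW lp)) // (ler_wpM2l (ltW Tp)) //; lra.
have h2 : m' * l ^+ 2 <= n' * l ^+ 2 by rewrite ler_wpM2r // sqr_ge0.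
have h3 : n' * l ^+ 2 = l * (T' * Q') / 2.
  suff nl : n' * l = T' * Q' / 2 by rewrite expr2 mulrA nl; ring.
  rewrite lamF TF.
  have -> : Q' * r' * Q' = (16 * n' ^+ 2 * r') * r' * Q' by rewrite -QF; ring.
  by field.
(* In units of [X] the contradiction reads 8 <= 3 + 4. *)
pose X := n' * T' * Q' ^+ 2 * r' ^+ 2.
have X0 : 0 < X by rewrite /X !mulr_gt0 ?exprn_gt0 //; lra.
have lX : l * (T' * Q') = 8 * X by rewrite lamF /X; ring.
have WX : W <= 3 * X.
  apply: le_trans normF _; have -> : 3 * X = T' * (n' * (Q' * r') ^+ 2 + 2 * (n' * (T' * (Q' * r')))).
    by rewrite /X TF; ring.
  have p0 : 0 <= T' * (Q' * r') by rewrite !mulr_ge0 //; lra.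
  rewrite (ler_wpM2l (ltW Tp)) // lerD //; first by rewrite ler_wpM2r ?sqr_ge0.
  by rewrite ler_wpM2l // ler_wpM2r.
clear -h1 h2 h3 lX WX X0 upper; move: h1 upper h2; rewrite h3 lX; lra.
Qed.

(** * A circuit for the perceptron *)

Section PerceptronCircuit.
Variables (n m K T M Q rho : nat) (zs : nat -> seq bool).
Variables (a : nat -> nat -> int) (theta : int).

(** The only part of the points that depends on the input, and it is common to all [k]; the numbers
    [a k j] are built into the circuit. *)
Definition offset (j : nat) (x : seq bool) : int :=
  Q%:Z * (2 * (hamming n (zs j) x)%:Z - 1).
Definition point (x : seq bool) (k j : nat) : int := a k j - offset j x.
Definition weight (t j : nat) (x : seq bool) : int :=
  perceptron m K (point x) theta t j.
Definition choice_at (t : nat) (x : seq bool) : nat :=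
  choose_point m K (point x) theta (perceptron m K (point x) theta t).

Hypothesis point_bound : forall x k j, size x = n -> (k < K)%N -> (j < m)%N ->
  `|point x k j| <= rho%:Z.
(** The terms dominate the offsets, the indices with the failure value [K], the points, the weights
    and the partial scalar products. *)
Hypothesis M_large :
  (Q * (2 * n).+1 + K + rho + T * rho + m * (rho * (T * rho)) < M)%N.

Let C := op_cost M.

Definition state (t : nat) (f : seq bool -> int) : Prop :=
  (exists2 j, (j < m)%N & offset j = f) \/ (exists2 j, (j < m)%N & weight t j = f).

Lemma offset_range i s : (i <= n)%N -> (s <= i)%N ->
  (`|(Q%:Z * (2 * s%:Z - 1))%R| <= M)%N.
Proof.
move=> hin hsi; have : (`|(Q%:Z * (2 * s%:Z - 1))%R| <= Q * (2 * n).+1)%N.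
  by rewrite abszM leq_mul //; lia.
lia.
Qed.

Lemma offset_bounded j : bounded n M (offset j).
Proof. by move=> x _; apply: (offset_range (leqnn n)); apply: hamming_le. Qed.

Lemma weight_bound t j x : size x = n -> (t <= T)%N -> (j < m)%N ->
  (`|weight t j x| <= T * rho)%N.
Proof.
move=> sx tT jm; have := perceptron_bound theta (fun k j => @point_bound x k j sx) t jm.
have : (t * rho <= T * rho)%N by rewrite leq_mul2r tT orbT.
rewrite /weight; lia.
Qed.

Lemma weight_bounded t j : (t <= T)%N -> (j < m)%N -> bounded n M (weight t j).
Proof. by move=> tT jm x sx; have := weight_bound sx tT jm; lia. Qed.

Lemma point_absz x k j : size x = n -> (k < K)%N -> (j < m)%N ->
  (`|point x k j| <= rho)%N.
Proof. by move=> sx kK jm; have := point_bound sx kK jm; lia. Qed.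

Lemma offset_extensible F j :
  extensible n (available_int n M) (C + n * (C + C)) F (eq (offset j)).
Proof.
pose part i x : int := Q%:Z * (2 * (\sum_(i' < i) (nth false (zs j) i' (+) nth false x i'))%N%:Z - 1).
apply: (extensible_fold (@available_int_cat n M) (a := part)).
  by apply: (extensible_int_const (k := - Q%:Z)) => x _; rewrite /part big_ord0; lia.
move=> i ilt.
apply: (extensible_let (@available_int_cat n M) (extensible_int_input ilt)).
apply: (@extensible_op n M _ (part i) (fun x => Posz (nth false x i)) _
  (fun u v => u + Q%:Z * (2 * (nth false (zs j) i (+) (v == 1))%N%:Z))).
- by left; right.
- by right.
- move=> x _; apply: (offset_range (ltnW ilt)); apply: hamming_le.
- by move=> x _; case: nth => //=; lia.
- move=> x _; rewrite /part big_ord_recr /= PoszD.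
  have -> : (Posz (nth false x i) == 1) = nth false x i by case: nth.
  lia.
Qed.

Definition partial_dot (t k i : nat) (x : seq bool) : int :=
  \sum_(j < i) point x k j * weight t j x.

Lemma term_bound t k j x : size x = n -> (t <= T)%N -> (k < K)%N -> (j < m)%N ->
  (`|(point x k j * weight t j x)%R| <= rho * (T * rho))%N.
Proof. by move=> sx tT kK jm; rewrite abszM leq_mul ?point_absz ?weight_bound. Qed.

Lemma partial_dot_bounded t k i : (t <= T)%N -> (k < K)%N -> (i <= m)%N ->
  bounded n M (partial_dot t k i).
Proof.
move=> tT kK im x sx; suff : (`|partial_dot t k i x| <= i * (rho * (T * rho)))%N.
  have : (i * (rho * (T * rho)) <= m * (rho * (T * rho)))%N by rewrite leq_mul2r im orbT.
  by move: M_large; lia.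
elim: i im => [|i IH] im; first by rewrite /partial_dot big_ord0.
rewrite /partial_dot big_ord_recr /= -/(partial_dot t k i x).
by have := IH (ltnW im); have := term_bound sx tT kK im; rewrite mulSn; lia.
Qed.

Lemma dot_extensible t k : (t <= T)%N -> (k < K)%N ->
  extensible n (available_int n M) (C + m * (C + C)) (state t)
    (eq (partial_dot t k m)).
Proof.
move=> tT kK; pose part := partial_dot t k.
apply: (extensible_fold (@available_int_cat n M) (a := part)).
  by apply: (extensible_int_const (k := 0)) => x _; rewrite /part /partial_dot big_ord0.
move=> i im.
apply: (extensible_let (@available_int_cat n M) (G := eq (fun x => point x k i * weight t i x))).
  (* The constant [a k i] is absorbed into the table of the operation. *)
  apply: (extensible_op (f := offset i) (g := weight t i) (phi := fun u v => (a k i - u) * v)) => //.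
  - by left; left; exists i.
  - by left; right; exists i.
  - exact: offset_bounded.
  - exact: weight_bounded.
apply: (extensible_op (f := part i) (g := fun x => point x k i * weight t i x) (phi := fun u v => u + v)).
- by left; right.
- by right.
- exact: partial_dot_bounded (ltnW im).
- move=> x sx; have := term_bound sx tT kK im.
  have : (rho * (T * rho) <= m * (rho * (T * rho)))%N.
    by rewrite leq_pmull // (leq_ltn_trans _ im).
  lia.
- by move=> x sx; rewrite /part /partial_dot big_ord_recr.
Qed.

Lemma choice_extensible t : (t <= T)%N ->
  extensible n (available_int n M) (C + K * (C + m * (C + C) + C)) (state t)
    (eq (fun x => Posz (choice_at t x))).
Proof.
move=> tT.
pose d x k := partial_dot t k m x.
pose part i x := Posz (select (fun k => d x k <= theta) K i).
apply: (extensible_fold (@available_int_cat n M) (a := part)).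
  exact: (extensible_int_const (k := K)).
move=> i iK; apply: (extensible_let (@available_int_cat n M) (G := eq (d^~ i))).
  by apply: extensible_sub (dot_extensible tT iK) => // f; left.
apply: (extensible_op (f := d^~ i) (g := part i)
  (phi := fun u v => if u <= theta then Posz i else v)).
- by right.
- by left; right.
- exact: partial_dot_bounded.
- by move=> x sx; have := select_le (fun k => d x k <= theta) (ltnW iK); rewrite /part; lia.
- by move=> x sx; rewrite /part /=; case: ifP.
Qed.

Lemma state_extensible t : (t < T)%N ->
  extensible n (available_int n M)
    (C + K * (C + m * (C + C) + C) + m * (C + C)) (state t) (state t.+1).
Proof.
move=> tT.
have : extensible n (available_int n M)
    (C + K * (C + m * (C + C) + C) + m * (C + C)) (state t)
    (fun f => exists2 j, (j < m)%N & weight t.+1 j = f).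
  apply: (extensible_let (@available_int_cat n M) (choice_extensible (ltnW tT))).
  apply: (extensible_bigcup (@available_int_cat n M)) => j jm.
  pose u x : int := if (choice_at t x < K)%N then point x (choice_at t x) j else 0.
  apply: (extensible_let (@available_int_cat n M) (G := eq u)).
    (* The table contains [a c j] for every index [c], so indexing by a computed choice is a single
       operation. *)
    apply: (extensible_op (f := fun x => Posz (choice_at t x)) (g := offset j)
      (phi := fun c v => if (absz c < K)%N then a (absz c) j - v else 0)) => //.
    - by right.
    - by left; left; exists j.
    - move=> x sx; have := select_le (fun k => dot m (point x k) (perceptron m K (point x) theta t) <= theta) (leqnn K).
      by rewrite /choice_at /choose_point; lia.
    - exact: offset_bounded.
  apply: (extensible_op (f := weight t j) (g := u) (phi := fun c v => c + v)) => //.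
  - by left; left; right; exists j.
  - by right.
  - exact: weight_bounded (ltnW tT) jm.
  - by move=> x sx; rewrite /u; case: ifP => // cK; have := point_absz sx cK jm; lia.
move/(extensible_keep (@available_int_cat n M)); apply: extensible_sub => // f [jf|jf].
  by left; left.
by right.
Qed.

Definition circuit_cost : nat :=
  m * (C + n * (C + C)) + m * C + T * (C + K * (C + m * (C + C) + C) + m * (C + C))
  + (C + K * (C + m * (C + C) + C)) + C.

Lemma perceptron_circuit : exists c, [/\ circuit_wf n c, (size c <= circuit_cost.+1)%N &
  forall x, size x = n -> circuit_out c x = (choice_at T x < K)%N].
Proof.
pose h x : int := if (choice_at T x < K)%N then 1 else 0.
have [||c [wc sc cE]] := @circuit_of_signal n M circuit_cost h; first by lia.
  have e0 : extensible n (available_int n M) (m * (C + n * (C + C)) + m * C)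
      (fun=> False) (state 0).
    apply: (extensible_union (@available_int_cat n M)).
      by apply: (extensible_bigcup (@available_int_cat n M)) => j _; apply: offset_extensible.
    apply: (extensible_bigcup (@available_int_cat n M)) => j _.
    exact: (extensible_int_const (k := 0)).
  have eT := extensible_trans e0 (extensible_iter state_extensible).
  have eC := extensible_trans eT (choice_extensible (leqnn T)).
  apply: extensible_trans eC _.
  apply: (extensible_op1 (f := fun x => Posz (choice_at T x))
      (phi := fun c => if (absz c < K)%N then 1 else 0)) => //.
  move=> x sx; have := select_le (fun k => dot m (point x k) (perceptron m K (point x) theta T) <= theta) (leqnn K).
  by rewrite /choice_at /choose_point; lia.
exists c; split=> // x sx; rewrite cE // /h.
by case: ifP.
Qed.

End PerceptronCircuit.

(** * Choice of parameters and conclusion *)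

Lemma circuit_cost_leq n m N K T M :
  (m <= N)%N -> (circuit_cost n m K T M <= circuit_cost n N K T M)%N.
Proof.
by move=> mN; rewrite /circuit_cost !(leq_add, leq_mul) // ?(leq_add, leq_mul).
Qed.

Lemma is_polynomial_circuit_cost N K T M :
  is_polynomial N -> is_polynomial K -> is_polynomial T -> is_polynomial M ->
  is_polynomial (fun n => circuit_cost n (N n) (K n) (T n) (M n)).
Proof.
move=> pN pK pT pM; rewrite /circuit_cost /op_cost.
by repeat first [assumption | exact: is_polynomial_id | exact: is_polynomial_const
  | apply: is_polynomialD | apply: is_polynomialM | apply: is_polynomialS].
Qed.

Theorem theorem7 : forall L : language, CF L -> Ppoly L.
Proof.
move=> L [p [pp LP]].
pose N n := (n + 1 + (p n + 1))%N.
(* [Q n * r n] bounds the coordinates of the points: the first summand accounts for [a], the second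
   for the offset. *)
pose r n := ((p n + 1) * (2 * n.+1) + (2 * n).+1)%N.
pose Q n := (16 * N n ^ 2 * r n)%N.
pose T n := (Q n * r n)%N.
pose rho n := (Q n * r n)%N.
pose M n := (Q n * (2 * n).+1 + (p n).+2 + rho n + T n * rho n
  + N n * (rho n * (T n * rho n))).+1%N.
(* The number of spanner points varies with the slice; its polynomial bound [N n] stands in for
   it. *)
exists (fun n => (circuit_cost n (N n) (p n).+2 (T n) (M n)).+1); split.
  apply/is_polynomialS/is_polynomial_circuit_cost; rewrite /M /rho /T /Q /r /N;
  by repeat first [assumption | exact: is_polynomial_id | exact: is_polynomial_const
    | apply: is_polynomialD | apply: is_polynomialM | apply: is_polynomialS].
move=> n; have [A [B [b Lb]]] := LP n.
(* The Farkas certificates require a member of the slice; an empty slice gets the constant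
   circuit. *)
have [[x0 Lx0]|empty] := pselect (exists x0 : n.-tuple bool, L x0); last first.
  exists [:: GConst false]; split=> //; split=> // x sx; split=> //.
    by move=> Lx; case: empty; exists (Tuple (introT eqP sx)).
  by rewrite /circuit_out /circuit_wires /= last_rcons.
have [m [zs [a [mN a_bound xP]]]] := threshold_points (Q n) Lb Lx0.
(* The least threshold that [perceptron_complete] allows. *)
pose theta : int := (m * (T n * (Q n * r n)))%N%:Z.
have P_bound x k j : size x = n -> (k < (p n).+2)%N -> (j < m)%N ->
    `|point n (Q n) zs a x k j| <= (rho n)%:Z.
  move=> sx _ _; rewrite /point /offset.
  have := a_bound k j; have := hamming_le n (zs j) x.
  rewrite /rho /r mulnDr; move: (hamming _ _ _) (a k j) => h v hn.
  have : `|(Q n)%:Z * (2 * h%:Z - 1)| <= (Q n * (2 * n).+1)%N%:Z.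
    by rewrite normrM PoszM ler_wpM2l //; lia.
  lia.
have M_large : (Q n * (2 * n).+1 + (p n).+2 + rho n + T n * rho n
    + m * (rho n * (T n * rho n)) < M n)%N.
  by rewrite ltnS leq_add2l leq_mul2r mN orbT.
have [c [wc sc cE]] := perceptron_circuit theta P_bound M_large.
exists c; split=> //; split=> [|x sx].
  by apply: leq_trans sc _; rewrite ltnS circuit_cost_leq.
have [accept reject] := xP x sx; rewrite cE //; split=> [/accept[lam [l0 l1 lP]]|ch].
  exact: (perceptron_complete (fun k j => @P_bound x k j sx) l0 l1 lP).
apply: contrapT => /reject[al [al1 alP]].
apply: (@perceptron_separated R m (N n) (p n).+2 (r n) (Q n) (T n)
  (point n (Q n) zs a x) theta al) => //.
- by rewrite /N addn1.
- by rewrite /r addnS.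
- by move=> k j; apply: P_bound.
Qed.
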